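(* For any dimension $d\ge 1$, we have \[ \tau^{(d)}_1=2^{2-d}\,3^{-1}. \]
   Context: For integers $d\ge 1$, $n\ge 2$, the $d$-dimensional toroidal kings graph $T^{(d)}[n]$ has vertex set $\{1,\ldots,n\}^d$, with coordinates read modulo $n$; distinct vertices $v,u$ are neighbors if and only if $v_i-u_i\equiv -1,0$ or $1\pmod n$ for each $i\in\{1,\ldots,d\}$. (When $n=2$ neighbors are counted with multiplicity, the number of neighbors of $v$ in $S$ being the number of nonzero $y\in\{-1,0,1\}^d$ with $v+y\in S$.) A set $S$ of vertices is $k$-dependent if each vertex of $S$ has at most $k$ neighbors in $S$. Let $\beta_k(T^{(d)}[n])$ be the maximum cardinality of a $k$-dependent set in $T^{(d)}[n]$, let $\tau^{(d)}_k(n)=\beta_k(T^{(d)}[n])/n^d$, and let $\tau^{(d)}_k=\lim_{n\to\infty}\tau^{(d)}_k(n)$ (this limit exists). *)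

(* Defs.v *)
From mathcomp Require Import all_boot all_order all_algebra.
From mathcomp Require Import all_classical all_reals all_analysis.

Set Implicit Arguments.
Unset Strict Implicit.
Unset Printing Implicit Defensive.

Import Order.TTheory GRing.Theory Num.Theory.
Import numFieldNormedType.Exports.
Local Open Scope ring_scope.

(* ['Z_n] is Z/nZ only for [1 < n]: below, the torus is meaningful for
   [1 < n], and the values at n = 0, 1 are junk that no limit sees. *)
Notation torus d n := {ffun 'I_d -> 'Z_n}.

Definition kings_adj (d n : nat) : rel (torus d n) :=
  fun v u => (v != u) && [forall i, v i - u i \in [:: -1; 0; 1]].

(* [y : {ffun 'I_d -> 'I_3}] encodes the vector of {-1,0,1}^d whose i-th
   coordinate is the integer [offset (y i)]. *)
Definition offset (e : 'I_3) : int := (e : nat)%:Z - 1.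

Definition translate (d n : nat) (v : torus d n) (y : {ffun 'I_d -> 'I_3}) :
  torus d n := [ffun i => v i + (offset (y i))%:~R].

(* For n = 2 the offsets 1 and -1 coincide modulo n, and neighbors are counted
   with multiplicity. *)
Definition neighbors_in (d n : nat) (S : {set torus d n}) (v : torus d n) :
  nat :=
  if n == 2%N then
    #|[set y : {ffun 'I_d -> 'I_3} |
        [exists i, offset (y i) != 0] && (translate v y \in S)]|
  else #|[set u in S | kings_adj v u]|.

Definition k_dependent (d n k : nat) (S : {set torus d n}) : bool :=
  [forall v in S, (neighbors_in S v <= k)%N].

Definition beta (d k n : nat) : nat :=
  \max_(S : {set torus d n} | k_dependent k S) #|S|.

Definition tau_n (R : realType) (d k n : nat) : R :=
  (beta d k n)%:R / n%:R ^+ d.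

Definition tau (R : realType) (d k : nat) : R := limn (tau_n R d k).

(* Main.v *)
Require Import Defs.
From mathcomp Require Import all_boot all_order all_algebra.
From mathcomp Require Import all_classical all_reals all_analysis.
From mathcomp Require Import zify ring.

Import Order.TTheory GRing.Theory Num.Theory.
Import numFieldNormedType.Exports.
Local Open Scope ring_scope.

(** Both bounds come from the [n ^ d] unit cubes [x + {0,1}^d] of the torus.

    Upper bound, for [n > 2].  A cube is a clique, so it meets a 1-dependent
    set [S] in at most two points.  Let a cube give weight 2 to its point of
    [S] when there is only one, and weight 1 to each when there are two: no
    cube gives more than 2, so the total is at most [2 * n ^ d]
    ([card_cube_trace]).  Conversely, a point [v] of [S] lies in [2 ^ d] cubes,
    one for each corner that it can occupy.  If [v] has a neighbor [u] in [S],
    some coordinate [i] separates them, and among the cubes containing [v] only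
    those lying on the side of [u] in direction [i], which are half of them,
    can contain [u] ([shared_le_half]).  Hence [v] receives at least
    [2 ^ d + 2 ^ d / 2], and [3 * 2 ^ d * #|S| <= 4 * n ^ d]
    ([card_one_dependent_le]).

    Lower bound.  Equality requires that each point have a neighbor differing
    in a single coordinate and that every cube meet [S].  This is what packing
    the torus by boxes of sides 3, 2, ..., 2 gives, with a pair of points
    adjacent along the long side in each box.  When 6 does not divide [n], a
    bounded margin is left empty in each direction ([beta_lower]).

    The two bounds have the same limit after division by [n ^ d], because
    [(n %/ m) / n] tends to [1 / m]. *)

(** * Unit cubes *)

Definition corner (d n : nat) (b : {ffun 'I_d -> bool}) : torus d n :=
  [ffun i => (b i)%:R].

Lemma corner_inj d n : injective (@corner d n).
Proof.
move=> b c /ffunP bc; apply/ffunP => i; move: (bc i); rewrite !ffunE.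
by case: (b i); case: (c i).
Qed.

Lemma cube_clique d n (x : torus d n) (b c : {ffun 'I_d -> bool}) :
  b != c -> kings_adj (x + corner d n b) (x + corner d n c).
Proof.
move=> bc; apply/andP; split.
  by apply: contra bc => /eqP /addrI /corner_inj ->.
apply/forallP => i; rewrite !ffunE opprD addrACA subrr add0r !inE.
by case: (b i); case: (c i); rewrite ?subr0 ?sub0r ?subrr eqxx ?orbT.
Qed.

(** The points of [S] in the cube at [x] are recorded by the corners that they
    occupy, so that cubes at different [x] share one index type. *)
Definition cube_trace {d n} (S : {set torus d n}) (x : torus d n) :
  {set {ffun 'I_d -> bool}} := [set b | x + corner d n b \in S].

Lemma neighbor_unique {d n} (S : {set torus d n}) (u v w : torus d n) :
    n != 2%N -> k_dependent 1 S -> v \in S ->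
  u \in S -> kings_adj v u -> w \in S -> kings_adj v w -> u = w.
Proof.
move=> n2 /forallP /(_ v) /implyP dS vS uS vu wS vw.
move: (dS vS); rewrite /neighbors_in (negbTE n2) => /card_le1_eqP; apply.
  by rewrite inE wS.
by rewrite inE uS.
Qed.

(** Of three points of [S] in a clique, each would have two neighbors. *)
Lemma card_cube_trace d n (S : {set torus d n}) (x : torus d n) :
  n != 2%N -> k_dependent 1 S -> (#|cube_trace S x| <= 2)%N.
Proof.
move=> n2 dS; rewrite leqNgt; apply/negP => /card_gt2P.
move=> [a [b [c [[]]]]]; rewrite !inE => aS bS cS [ab bc ca].
have := neighbor_unique S _ _ _ n2 dS aS bS (cube_clique _ _ _ _ _ ab) cS.
rewrite eq_sym in ca => /(_ (cube_clique _ _ _ _ _ ca)) /addrI /corner_inj.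
by apply/eqP.
Qed.

(** * Upper bound *)

Definition flip {d} (i : 'I_d) (b : {ffun 'I_d -> bool}) :
  {ffun 'I_d -> bool} := [ffun j => if j == i then ~~ b j else b j].

Lemma flip_inj d (i : 'I_d) : injective (flip i).
Proof.
move=> b c /ffunP bc; apply/ffunP => j; move: (bc j); rewrite !ffunE.
by case: eqP => // _ /negb_inj.
Qed.

(** A cube containing [v] is named by the corner [b] that [v] occupies in it;
    its base point is then [v - corner d n b]. *)
Definition shared {d n} (S : {set torus d n}) (v : torus d n) :
  {set {ffun 'I_d -> bool}} :=
  [set b | #|cube_trace S (v - corner d n b)| != 1%N].

Lemma sharedP {d n} {S : {set torus d n}} {v : torus d n} {b} :
  v \in S -> b \in shared S v ->
  exists2 c, b != c & v - corner d n b + corner d n c \in S.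
Proof.
move=> vS; rewrite inE => bS.
have bT : b \in cube_trace S (v - corner d n b) by rewrite inE subrK.
have /card_gt1P [a [c [aT cT ac]]] :
    (1 < #|cube_trace S (v - corner d n b)%R|)%N.
  by rewrite ltn_neqAle eq_sym bS card_gt0; apply/set0Pn; exists b.
have [ba|ba] := eqVneq b a.
  by exists c; [rewrite ba | rewrite inE in cT].
by exists a => //; rewrite inE in aT.
Qed.

(** A point has two distinct sides in each direction; for [n = 2] they would
    coincide. *)
Lemma Zp_one_neq_opp n : (2 < n)%N -> (1 : 'Z_n) != -1.
Proof.
move=> n2; rewrite -addr_eq0 -[1 + 1]/(2%:R : 'Z_n).
apply/eqP => /(congr1 (@nat_of_ord _)); rewrite val_Zp_nat ?modn_small //; lia.
Qed.

(** All shared cubes of [v] contain the same neighbor [u].  If [u] and [v]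
    differ in coordinate [i], then [u i - v i] is 1 or -1 and dictates which
    side [v] occupies in direction [i] in such a cube; so [flip i] sends shared
    corners to corners that are not shared. *)
Lemma shared_le_half d n (S : {set torus d n}) (v : torus d n) :
  (2 < n)%N -> k_dependent 1 S -> v \in S ->
  (2 * #|shared S v| <= 2 ^ d)%N.
Proof.
move=> n2 dS vS; have nn2 : n != 2%N by lia.
have [->|/set0Pn [b0 b0S]] := eqVneq (shared S v) finset.set0.
  by rewrite cards0.
have adjv b c : b != c -> kings_adj v (v - corner d n b + corner d n c).
  by move=> /cube_clique -/(_ n (v - corner d n b)); rewrite subrK.
have [c0 bc0 uS] := sharedP vS b0S.
set u := v - _ + _ in uS.
have {}bc0 : kings_adj v u by exact: adjv.
have [i vui] : exists i, v i != u i.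
  apply/existsP; rewrite -negb_forall; apply: contraL bc0 => /forallP vu.
  rewrite /kings_adj negb_and negbK; apply/orP; left.
  by apply/eqP/ffunP => i; apply/eqP.
(* The corner [c] occupied by [u] satisfies [c i - b i = u i - v i], which is
   nonzero, so [b i] is 1 exactly when this difference is -1. *)
have bi b : b \in shared S v -> b i = (u i - v i == -1).
  move=> /(sharedP vS) [c bc cS].
  have := neighbor_unique S _ _ _ nn2 dS vS uS bc0 cS (adjv _ _ bc).
  move=> /ffunP /(_ i) ui; move: vui; rewrite ui !ffunE.
  rewrite -(addrA (v i)) [v i + _]addrC addrK eq_sym -subr_eq0 addrK.
  case: (b i); case: (c i);
    rewrite ?mulr0n ?mulr1n ?oppr0 ?addr0 ?addNr ?add0r ?eqxx //.
  by rewrite (negbTE (Zp_one_neq_opp _ n2)).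
set F := [set flip i b | b in shared S v].
have dis : [disjoint shared S v & F].
  apply/pred0P => b /=; apply/negP => /andP [bS /imsetP [c cS bc]].
  by move: (bi _ bS); rewrite bc ffunE eqxx (bi _ cS); case: eqP.
have /eqP FU : #|shared S v :|: F| == (#|shared S v| + #|F|)%N.
  by rewrite (leq_card_setU _ _).2.
have := subset_leq_card (finset.subsetT (shared S v :|: F)).
rewrite FU card_imset; last exact: flip_inj.
by rewrite cardsT card_ffun card_bool card_ord addnn mul2n.
Qed.

Lemma card_torus d n : (1 < n)%N -> #|{: torus d n}| = (n ^ d)%N.
Proof. by move=> n1; rewrite card_ffun !card_ord Zp_cast. Qed.

(** Double counting of the weights given by cubes to the points of [S]. *)
Lemma card_one_dependent_le d n (S : {set torus d n}) :
  (2 < n)%N -> k_dependent 1 S -> (3 * 2 ^ d * #|S| <= 4 * n ^ d)%N.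
Proof.
move=> n2 dS.
(* If the cube at [x] contains [k] points of [S], where [k <= 2], each of them
   receives [w x] and [k * w x <= 2]. *)
pose w x := (1 + (#|cube_trace S x| == 1))%N.
have wT x : (\sum_(b in cube_trace S x) w x <= 2)%N.
  have nn2 : n != 2%N by lia.
  rewrite sum_nat_const /w; have := card_cube_trace _ _ S x nn2 dS.
  by case: #|_| => [|[|[|]]].
have upper : (\sum_x \sum_(b in cube_trace S x) w x <= 2 * n ^ d)%N.
  rewrite mulnC -card_torus; last lia.
  by rewrite -sum_nat_const; apply: leq_sum => x _.
have lower v : v \in S ->
    (3 * 2 ^ d <= 2 * \sum_b w (v - corner d n b)%R)%N.
  move=> vS; have half := shared_le_half _ _ _ _ n2 dS vS.
  have -> : (\sum_b w (v - corner d n b)%R = 2 ^ d + #|~: shared S v|)%N.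
    rewrite big_split /= sum1_card card_ffun card_bool card_ord; congr addn.
    rewrite -sum1_card [RHS]big_mkcond; apply: eq_bigr => b _.
    by rewrite !inE negbK; case: eqP.
  have := cardsC (shared S v); rewrite card_ffun card_bool card_ord; lia.
(* For a fixed corner [b], the base point [x] and the point [x + corner b]
   determine each other. *)
have swap : (\sum_x \sum_(b in cube_trace S x) w x =
             \sum_(v in S) \sum_b w (v - corner d n b)%R)%N.
  under eq_bigr do rewrite big_mkcond.
  rewrite exchange_big [RHS]exchange_big; apply: eq_bigr => b _.
  rewrite -big_mkcond /= (reindex_inj (addIr (- corner d n b))) /=.
  by apply: eq_bigl => v; rewrite inE subrK.
have : (\sum_(v in S) 3 * 2 ^ d <=
        \sum_(v in S) 2 * \sum_b w (v - corner d n b)%R)%N by exact: leq_sum.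
rewrite sum_nat_const -big_distrr -swap /= mulnC => /leq_trans; apply.
by rewrite -[4%N]/(2 * 2)%N -mulnA leq_mul2l.
Qed.

Lemma beta_upper d n :
  (2 < n)%N -> (3 * 2 ^ d * beta d 1 n <= 4 * n ^ d)%N.
Proof.
move=> n2; rewrite /beta; elim/big_ind: _ => [|x y hx hy|S dS].
- by rewrite muln0.
- by rewrite /maxn; case: ifP.
- exact: card_one_dependent_le.
Qed.

(** * Lower bound *)

(** Since neither [a] nor [b] is the last residue [n - 1], closeness modulo [n]
    cannot come from wrapping around. *)
Lemma Zp_close n (a b : nat) : (a.+1 < n)%N -> (b.+1 < n)%N ->
    (a%:R - b%:R : 'Z_n) \in [:: -1; 0; 1] ->
  (a <= b.+1)%N /\ (b <= a.+1)%N.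
Proof.
move=> an bn.
have nat_eq (k l : nat) : (k < n)%N -> (l < n)%N ->
    k%:R - l%:R = 0 :> 'Z_n -> k = l.
  move=> kn ln /eqP; rewrite subr_eq0 => /eqP /(congr1 (@nat_of_ord _)).
  by rewrite !val_Zp_nat ?modn_small //; lia.
rewrite !inE => /or3P [] /eqP ab.
- suff: a.+1 = b by lia.
  by apply: nat_eq; [lia | lia | rewrite -natr1 addrAC ab addNr].
- suff: a = b by lia.
  by apply: nat_eq; [lia | lia |].
- suff: a = b.+1 by lia.
  by apply: nat_eq; [lia | lia | rewrite -natr1 opprD addrA ab subrr].
Qed.

(** The point of the pair in the box indexed by [t.1.1] along the first
    coordinate and by [t.2] along the others; [t.1.2] tells which of the two
    points. *)
Definition domino {d} n (q r : nat)
    (t : 'I_q * bool * {ffun 'I_d -> 'I_r}) : torus d.+1 n :=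
  [ffun i => if unlift ord0 i is Some j then (2 * t.2 j)%:R
             else (3 * t.1.1 + t.1.2)%:R].

(** Points of distinct boxes are never neighbors: in each box, the last layer in
    every direction is empty, and this also separates the last box from the
    first one around the torus. *)
Lemma domino_close {d n q r} (t s : 'I_q * bool * {ffun 'I_d -> 'I_r}) :
    (3 * q <= n)%N -> (2 * r <= n)%N ->
    (forall i, domino n q r t i - domino n q r s i \in [:: -1; 0; 1]) ->
  t.1.1 = s.1.1 /\ t.2 = s.2.
Proof.
move=> qn rn ts; split.
  have := ts ord0; rewrite !ffunE unlift_none => t0; apply/val_inj => /=.
  have tq := ltn_ord t.1.1; have sq := ltn_ord s.1.1.
  have [] : (3 * t.1.1 + t.1.2 <= (3 * s.1.1 + s.1.2).+1)%N /\
            (3 * s.1.1 + s.1.2 <= (3 * t.1.1 + t.1.2).+1)%N.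
    by apply: Zp_close t0; case: t.1.2; case: s.1.2; lia.
  by case: t.1.2; case: s.1.2; lia.
apply/ffunP => j; apply/val_inj => /=.
have := ts (lift ord0 j); rewrite !ffunE liftK => tj.
have tr := ltn_ord (t.2 j); have sr := ltn_ord (s.2 j).
have [] : (2 * t.2 j <= (2 * s.2 j).+1)%N /\ (2 * s.2 j <= (2 * t.2 j).+1)%N.
  by apply: Zp_close tj; lia.
lia.
Qed.

Lemma beta_lower d n : (2 < n)%N ->
  (2 * (n %/ 3) * (n %/ 2) ^ d <= beta d.+1 1 n)%N.
Proof.
move=> n2; pose D := domino (d := d) n (n %/ 3) (n %/ 2).
have qn : (3 * (n %/ 3) <= n)%N by lia.
have rn : (2 * (n %/ 2) <= n)%N by lia.
have twin t s : kings_adj (D t) (D s) -> s = (t.1.1, ~~ t.1.2, t.2).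
  move=> /andP [ts /forallP /(domino_close _ _ qn rn)].
  case: t s ts => [[k e] g] [[k' e'] g'] /= ts [kk gg]; move: ts.
  by rewrite -kk -gg; case: e; case: e'; rewrite ?eqxx.
have D_inj : injective D.
  move=> t s Dts.
  have [] : t.1.1 = s.1.1 /\ t.2 = s.2.
    apply: (domino_close _ _ qn rn) => i.
    by rewrite -/D Dts subrr !inE eqxx orbT.
  move: Dts => /ffunP /(_ ord0); rewrite !ffunE unlift_none.
  case: t s => [[k e] g] [[k' e'] g'] /= De kk gg; move: De.
  rewrite -kk -gg !natrD => /addrI; by case: e; case: e'.
pose S := [set D t | t : 'I_(n %/ 3) * bool * {ffun 'I_d -> 'I_(n %/ 2)}].
have -> : (2 * (n %/ 3) * (n %/ 2) ^ d)%N = #|S|.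
  rewrite card_imset // !card_prod card_bool card_ffun !card_ord.
  by rewrite [(2 * _)%N]mulnC.
apply: (leq_bigmax_cond (F := fun S : {set torus d.+1 n} => #|S|)).
apply/forallP => v; apply/implyP => /imsetP [t _ ->].
rewrite /neighbors_in ifF; last by apply/eqP; lia.
apply/card_le1_eqP => u w; rewrite !inE.
by move=> /andP [/imsetP [s _ ->] /twin ->] /andP [/imsetP [s' _ ->] /twin ->].
Qed.

(** * Density *)

Lemma cvg_divn_ratio (R : realType) (m : nat) : (0 < m)%N ->
  (((n %/ m)%:R / n%:R : R) @[n --> \oo] --> (m%:R^-1 : R))%classic.
Proof.
move=> m0; have mR : 0 < m%:R :> R by rewrite ltr0n.
apply: (@squeeze_cvgr _ _ _ _ (fun n => m%:R^-1 - n%:R^-1) (cst m%:R^-1)).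
- near=> n.
  have n0 : (0 < n)%N by near: n; exists 1%N.
  have nR : 0 < n%:R :> R by rewrite ltr0n.
  apply/andP; split.
    rewrite lerBlDr -[X in _ <= _ + X]mul1r -mulrDl natr1.
    rewrite ler_pdivlMr // mulrC ler_pdivrMr // -natrM ler_nat.
    by rewrite ltnW // ltn_ceil.
  rewrite ler_pdivrMr // mulrC ler_pdivlMr // -natrM ler_nat.
  exact: leq_trunc_div.
- rewrite -[X in (_ --> X)%classic]subr0; apply: cvgB; first exact: cvg_cst.
  apply: (gtr0_cvgV0 _).2; last exact: cvgr_idn.
  by exists 1%N => // n /= n0; rewrite ltr0n.
- exact: cvg_cst.
Unshelve. all: by end_near. Qed.

(** The dimension is [d.+1], so the value is [2 / (3 * 2 ^ d)]: two points in
    each box of sides 3, 2, ..., 2. *)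
Lemma cvg_tau_n (R : realType) d :
  (tau_n R d.+1 1 n @[n --> \oo] --> (2 * 3^-1 * 2^-1 ^+ d : R))%classic.
Proof.
apply: (@squeeze_cvgr _ _ _ _
  (fun n => 2 * ((n %/ 3)%:R / n%:R) * ((n %/ 2)%:R / n%:R) ^+ d)
  (cst (2 * 3^-1 * 2^-1 ^+ d))).
- near=> n.
  have n2 : (2 < n)%N by near: n; exists 3%N.
  have n0 : 0 < n%:R :> R by rewrite ltr0n; lia.
  apply/andP; split; rewrite /tau_n.
    rewrite ler_pdivlMr ?exprn_gt0 // exprS expr_div_n.
    have -> : 2 * ((n %/ 3)%:R / n%:R) * ((n %/ 2)%:R ^+ d / n%:R ^+ d) *
        (n%:R * n%:R ^+ d) = (2 * (n %/ 3) * (n %/ 2) ^ d)%:R :> R.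
      rewrite !natrM natrX; field.
      by rewrite expf_neq0 gt_eqF.
    by rewrite ler_nat; exact: beta_lower.
  rewrite ler_pdivrMr ?exprn_gt0 //.
  have := beta_upper d.+1 n n2.
  rewrite -(ler_nat R) !natrM !natrX [2%:R ^+ d.+1]exprS exprVn => h.
  rewrite -(ler_pM2l (_ : 0 < 3 * (2 * 2 ^+ d))) ?mulr_gt0 ?exprn_gt0 //.
  apply: (le_trans h); rewrite le_eqVlt; apply/orP; left; apply/eqP.
  by rewrite /cst; field; rewrite expf_neq0.
- apply: cvgM.
    by apply: cvgM; [exact: cvg_cst | exact: cvg_divn_ratio].
  by apply: (@continuous_cvg _ _ _ _ _ _ (fun x : R => x ^+ d));
    [exact: exprn_continuous | exact: cvg_divn_ratio].
- exact: cvg_cst.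
Unshelve. all: by end_near. Qed.

Theorem theorem5 (R : realType) (d : nat) (hd : (1 <= d)%N) :
  cvgn (tau_n R d 1) /\ tau R d 1 = 2 ^ (2 - d%:Z) * 3^-1.
Proof.
case: d hd => // d _; have lim := cvg_tau_n R d; split.
  by apply/cvg_ex; exists (2 * 3^-1 * 2^-1 ^+ d).
rewrite /tau (cvg_lim _ lim) //.
have -> : 2 - d.+1%:Z = 1 - d%:Z by lia.
by rewrite expfzDr // expr1z -exprz_inv mulrAC.
Qed.
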